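(* Let $V_R(\mathfrak{Q})$ be a separable right quaternionic Hilbert space and let $X=\{x_n\}_{n\in\mathbb{N}}$ be a sequence in $V_R(\mathfrak{Q})$. Then $X$ is a Riesz basis for $V_R(\mathfrak{Q})$ if and only if $X$ is a complete Riesz sequence in $V_R(\mathfrak{Q})$.
   Context: $\mathfrak{Q}$ is the skew field of real quaternions, with conjugation $q\mapsto\overline{q}$ and modulus $|q|=(\overline{q}q)^{1/2}$. A right quaternionic Hilbert space $V_R(\mathfrak{Q})$ is a right $\mathfrak{Q}$-vector space with a map $\langle\cdot|\cdot\rangle:V_R(\mathfrak{Q})\times V_R(\mathfrak{Q})\to\mathfrak{Q}$ satisfying $\overline{\langle v_1|v_2\rangle}=\langle v_2|v_1\rangle$, $\langle v|v\rangle>0$ for $v\neq 0$, $\langle v|v_1+v_2\rangle=\langle v|v_1\rangle+\langle v|v_2\rangle$, and $\langle v|uq\rangle=\langle v|u\rangle q$ for $q\in\mathfrak{Q}$, which is complete for the norm $\|u\|=\sqrt{\langle u|u\rangle}$. An operator $T$ on $V_R(\mathfrak{Q})$ is right linear if $T(v_1\alpha+v_2\beta)=T(v_1)\alpha+T(v_2)\beta$ for $\alpha,\beta\in\mathfrak{Q}$, and bounded if $\|T(v)\|\le K\|v\|$ for some $K\ge 0$ and all $v$. An orthonormal (Hilbert) basis $\{e_n\}_{n\in\mathbb{N}}$ of $V_R(\mathfrak{Q})$ is a sequence with $\langle e_i|e_j\rangle=\delta_{ij}$ whose right $\mathfrak{Q}$-linear span is dense in $V_R(\mathfrak{Q})$.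 A Riesz basis for $V_R(\mathfrak{Q})$ is a family of the form $\{U(e_n)\}_{n\in\mathbb{N}}$, where $\{e_n\}_{n\in\mathbb{N}}$ is an orthonormal basis of $V_R(\mathfrak{Q})$ and $U:V_R(\mathfrak{Q})\to V_R(\mathfrak{Q})$ is a bounded right linear bijective operator. A sequence $X=\{x_n\}_{n\in\mathbb{N}}$ in $V_R(\mathfrak{Q})$ is a Riesz sequence if there exist positive real numbers $A,B$ such that $A\sum_{n}|q_n|^2\le\|\sum_{n}x_nq_n\|^2\le B\sum_{n}|q_n|^2$ for all eventually zero sequences of quaternions $\{q_n\}_{n\in\mathbb{N}}$ (i.e. $q_n=0$ for all but finitely many $n$). $X$ is complete in $V_R(\mathfrak{Q})$ if the set of finite right $\mathfrak{Q}$-linear combinations of its elements is dense in $V_R(\mathfrak{Q})$. *)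

(* Defs.v *)
From HB Require Import structures.
From mathcomp Require Import all_boot all_order all_algebra.
From mathcomp Require Import all_classical all_reals all_analysis.
From mathcomp Require Import ring.

Set Implicit Arguments.
Unset Strict Implicit.
Unset Printing Implicit Defensive.

Import Order.TTheory GRing.Theory Num.Theory.
Import numFieldNormedType.Exports.

Local Open Scope classical_set_scope.
Local Open Scope ring_scope.

(** * Quaternions *)

Record quat (R : Type) := Quat { qre : R ; qi : R ; qj : R ; qk : R }.

Definition quat_tuple (R : Type) (q : quat R) := (qre q, qi q, qj q, qk q).
Definition tuple_quat (R : Type) (t : R * R * R * R) :=
  Quat t.1.1.1 t.1.1.2 t.1.2 t.2.

Lemma quat_tupleK (R : Type) : cancel (@quat_tuple R) (@tuple_quat R).
Proof. by case. Qed.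

HB.instance Definition _ (R : choiceType) :=
  Choice.copy (quat R) (can_type (@quat_tupleK R)).

Section QuatZmodule.
Variable R : realType.
Implicit Types p q : quat R.

Definition quat_add p q :=
  Quat (qre p + qre q) (qi p + qi q) (qj p + qj q) (qk p + qk q).
Definition quat_opp p := Quat (- qre p) (- qi p) (- qj p) (- qk p).

Lemma quat_addA : associative quat_add.
Proof. by move=> p q r; rewrite /quat_add /= !addrA. Qed.
Lemma quat_addC : commutative quat_add.
Proof. by move=> p q; congr Quat; rewrite addrC. Qed.
Lemma quat_add0q : left_id (Quat 0 0 0 0) quat_add.
Proof. by case=> *; rewrite /quat_add /= !add0r. Qed.
Lemma quat_addNq : left_inverse (Quat 0 0 0 0) quat_opp quat_add.
Proof. by move=> p; rewrite /quat_add /= !addNr. Qed.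

End QuatZmodule.

HB.instance Definition _ (R : realType) := GRing.isZmodule.Build (quat R)
  (@quat_addA R) (@quat_addC R) (@quat_add0q R) (@quat_addNq R).

Section QuatRing.
Variable R : realType.
Implicit Types p q : quat R.

Definition quat_mul p q := Quat
  (qre p * qre q - qi p * qi q - qj p * qj q - qk p * qk q)
  (qre p * qi q + qi p * qre q + qj p * qk q - qk p * qj q)
  (qre p * qj q - qi p * qk q + qj p * qre q + qk p * qi q)
  (qre p * qk q + qi p * qj q - qj p * qi q + qk p * qre q).

Lemma quat_mulA : associative quat_mul.
Proof. by move=> p q r; congr Quat => /=; ring. Qed.
Lemma quat_mul1q : left_id (Quat 1 0 0 0) quat_mul.
Proof. by case=> *; congr Quat => /=; ring. Qed.
Lemma quat_mulq1 : right_id (Quat 1 0 0 0) quat_mul.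
Proof. by case=> *; congr Quat => /=; ring. Qed.
Lemma quat_mulDl : left_distributive quat_mul +%R.
Proof. by move=> p q r; congr Quat => /=; ring. Qed.
Lemma quat_mulDr : right_distributive quat_mul +%R.
Proof. by move=> p q r; congr Quat => /=; ring. Qed.
Lemma quat1_neq0 : Quat 1 0 0 0 != 0 :> quat R.
Proof. by apply/eqP=> -[] /eqP; rewrite oner_eq0. Qed.

End QuatRing.

HB.instance Definition _ (R : realType) := GRing.Zmodule_isNzRing.Build (quat R)
  (@quat_mulA R) (@quat_mul1q R) (@quat_mulq1 R) (@quat_mulDl R) (@quat_mulDr R) (@quat1_neq0 R).

Section QuatDivision.
Variable R : realType.
Implicit Types p q : quat R.

Definition quatR (r : R) : quat R := Quat r 0 0 0.

Definition quat_conj q := Quat (qre q) (- qi q) (- qj q) (- qk q).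

(* [quat_conj q * q] is real, so its real part loses no information. *)
Definition quat_norm q : R := Num.sqrt (qre (quat_conj q * q)).

Lemma quat_conj_mul q : quat_conj q * q = quatR (qre (quat_conj q * q)).
Proof. by congr Quat => /=; ring. Qed.

Lemma quat_mul_conj q : q * quat_conj q = quatR (qre (quat_conj q * q)).
Proof. by congr Quat => /=; ring. Qed.

Lemma qre_conj_mul q :
  qre (quat_conj q * q) = qre q ^+ 2 + qi q ^+ 2 + qj q ^+ 2 + qk q ^+ 2.
Proof. by rewrite /=; ring. Qed.

Lemma qre_conj_mul_neq0 q : q != 0 -> qre (quat_conj q * q) != 0.
Proof.
apply: contra_neq; rewrite qre_conj_mul => /eqP.
rewrite !paddr_eq0 ?addr_ge0 ?sqr_ge0// !sqrf_eq0.
by case: q => a b c d /= /andP[/andP[/andP[/eqP-> /eqP->] /eqP->] /eqP->].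
Qed.

(* For [q = 0] this is [0], because [0^-1 = 0] in [R]. *)
Definition quat_inv q : quat R := quatR (qre (quat_conj q * q))^-1 * quat_conj q.

Lemma quatRM r s : quatR r * quatR s = quatR (r * s).
Proof. by congr Quat => /=; ring. Qed.

Lemma quatRC r q : quatR r * q = q * quatR r.
Proof. by congr Quat => /=; ring. Qed.

Lemma quat_mulVq : {in [pred q : quat R | q != 0], left_inverse 1 quat_inv *%R}.
Proof.
move=> q q0; rewrite /quat_inv -mulrA quat_conj_mul quatRM mulVf//.
exact: qre_conj_mul_neq0.
Qed.

Lemma quat_mulqV : {in [pred q : quat R | q != 0], right_inverse 1 quat_inv *%R}.
Proof.
move=> q q0; rewrite /quat_inv quatRC mulrA quat_mul_conj quatRM divff//.
exact: qre_conj_mul_neq0.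
Qed.

Lemma quat_unitP p q : q * p = 1 /\ p * q = 1 -> p != 0.
Proof.
by case=> qp1 _; apply/eqP => p0; move: qp1; rewrite p0 mulr0 => /esym/eqP;
   rewrite oner_eq0.
Qed.

Lemma quat_inv_out : {in [predC [pred q : quat R | q != 0]], quat_inv =1 id}.
Proof.
by move=> q; rewrite !inE negbK => /eqP->; congr Quat => /=; ring.
Qed.

End QuatDivision.

HB.instance Definition _ (R : realType) :=
  GRing.NzRing_hasMulInverse.Build (quat R)
  (@quat_mulVq R) (@quat_mulqV R) (@quat_unitP R) (@quat_inv_out R).

(** * Right quaternionic Hilbert spaces *)

(* The norm and the topology are those induced by the inner product: [normE]
   fixes the norm, and [PseudoMetricNormedZmod] makes its balls generate the
   topology and the uniform structure.  The right scaling and completeness are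
   fields, since HB accepts no join of [PseudoMetricNormedZmod] with
   [lmodType (quat R)^c] or with [completeType]: the join must precede
   [normedModType] and its complete version in the hierarchy. *)
HB.mixin Record isRightQuatHilbert (R : realType) V
    of PseudoMetricNormedZmod R V := {
  rscale : V -> quat R -> V ;
  rscaleA : forall v p q, rscale (rscale v p) q = rscale v (p * q) ;
  rscale1 : forall v, rscale v 1 = v ;
  rscaleDl : forall u v q, rscale (u + v) q = rscale u q + rscale v q ;
  rscaleDr : forall v p q, rscale v (p + q) = rscale v p + rscale v q ;
  qdot : V -> V -> quat R ;
  conj_qdot : forall u v, quat_conj (qdot u v) = qdot v u ;
  qdot_gt0 : forall v, v != 0 -> exists2 r : R, 0 < r & qdot v v = quatR r ;
  qdotDr : forall v v1 v2, qdot v (v1 + v2) = qdot v v1 + qdot v v2 ;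
  qdotZr : forall v u q, qdot v (rscale u q) = qdot v u * q ;
  normE : forall v, `|v| = Num.sqrt (qre (qdot v v)) ;
  hilbert_complete :
    forall F : set_system V, ProperFilter F -> cauchy F -> cvg F
}.

#[short(type="rightQuatHilbertType")]
HB.structure Definition RightQuatHilbert (R : realType) :=
  { V of PseudoMetricNormedZmod R V & isRightQuatHilbert R V }.

Notation "v *r q" := (rscale v q) (at level 40, left associativity).

Definition separable (T : topologicalType) :=
  exists2 A : set T, countable A & dense A.

Section RieszBasis.
Variables (R : realType) (V : rightQuatHilbertType R).
Implicit Types (x e : nat -> V) (T : V -> V).

Definition right_linear T := forall (v1 v2 : V) (a b : quat R),
  T (v1 *r a + v2 *r b) = T v1 *r a + T v2 *r b.

Definition bounded_op T :=
  exists2 K : R, 0 <= K & forall v, `|T v| <= K * `|v|.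

Definition right_span x : set V :=
  [set v | exists (n : nat) (q : nat -> quat R), v = \sum_(i < n) x i *r q i].

Definition complete_seq x := dense (right_span x).

Definition orthonormal_basis e :=
  (forall i j, qdot (e i) (e j) = (i == j)%:R) /\ dense (right_span e).

Definition riesz_basis x :=
  exists e U, orthonormal_basis e /\
    [/\ bounded_op U, right_linear U, bijective U & forall n, x n = U (e n)].

(* An eventually zero sequence is given with a rank [n] from which it
   vanishes; the sums then do not depend on the choice of [n]. *)
Definition riesz_seq x :=
  exists A B : R, [/\ 0 < A, 0 < B &
    forall (q : nat -> quat R) (n : nat), (forall i, (n <= i)%N -> q i = 0) ->
      A * (\sum_(i < n) quat_norm (q i) ^+ 2)
        <= `|\sum_(i < n) x i *r q i| ^+ 2
        <= B * (\sum_(i < n) quat_norm (q i) ^+ 2)].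

End RieszBasis.

(* Main.v *)
Require Import Defs.
From mathcomp Require Import all_boot all_order all_algebra.
From mathcomp Require Import all_classical all_reals all_analysis.
From HB Require Import structures.
From mathcomp Require Import ring lra.

(** A Riesz basis is the image of an orthonormal basis [e] under a bounded
    bijection [U].  By orthonormality [|sum e_i q_i|^2] is [sum |q_i|^2], so the
    two Riesz inequalities for [x = U e] say exactly that [U] is bounded above
    and below on the finite combinations of [e].

    From a Riesz basis to a complete Riesz sequence: the upper bound is the
    boundedness of [U], and completeness holds because [U] is continuous and
    onto.  The lower bound is the boundedness of the inverse of [U], which is
    Banach's inverse theorem ([bounded_inverse]), proved from Baire's theorem by
    successive approximation and applied to the Hilbert space seen as a real
    Banach space ([real_form]).

    From a complete Riesz sequence [x] to a Riesz basis: the lower bound makes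
    [x] right linearly independent, so that the Gram-Schmidt process turns it
    into an orthonormal [e] whose span contains [x] and is therefore dense.  The
    correspondence [sum e_i q_i <-> sum x_i q_i] is a linear relation between two
    dense subspaces, bounded in both directions by the Riesz inequalities.  Such
    a relation extends by completeness to a bounded bijection
    ([extend_linear_iso]), which maps [e_n] to [x_n]. *)

Set Implicit Arguments.
Unset Strict Implicit.
Unset Printing Implicit Defensive.

Import Order.TTheory GRing.Theory Num.Def Num.Theory.
Import numFieldNormedType.Exports.

Local Open Scope classical_set_scope.
Local Open Scope ring_scope.

(** * The bounded inverse theorem *)

Section BoundedInverse.
Variables (R : realType) (V W : completeNormedModType R) (U : {linear V -> W}).

(** Where Baire's theorem enters: [W] is the union of the closures of the images
    of the balls of [V], so one of them contains a ball, which can be recentred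
    at [0] by taking differences and then rescaled to reach any [v]. *)
Lemma approximate_inverse_bound : bijective U -> exists2 K : R, 0 < K &
  forall v (eps : R), 0 < eps ->
    exists2 z, `|z| <= K * `|v| & `|v - U z| < eps.
Proof.
move=> [S US SU].
pose C n : set W := closure [set U z | z in [set z | `|z| <= n%:R]].
have [n [x0 [r r0 ballC]]] : exists n (x : W), exists2 r : R, 0 < r & ball x r `<=` C n.
  have /existsNP[n Hn] : ~ forall n, dense (~` C n).
    move=> dC.
    have : dense (\bigcap_n ~` C n).
      by apply: Baire => n; split=> //; rewrite openC; exact: closed_closure.
    move=> /(_ setT) []; [by exists 0 | exact: openT |] => w [_ Hw].
    apply: (Hw (truncn `|S w|).+1 I); apply: subset_closure.
    by exists (S w) => //=; rewrite ltW// truncnS_gt.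
  have [D [[x Dx] DC]] := denseNE Hn; exists n, x.
  have /nbhs_ballP[r r0 bD] := open_nbhs_nbhs Dx.
  exists r => // y /bD Dy; apply: contrapT => nC.
  by have : (D `&` ~` C n) y by []; rewrite DC.
have near_image y e : C n y -> 0 < e -> exists2 z, `|z| <= n%:R & `|y - U z| < e.
  move=> Cy e0; have [_ [[z zn <-]]] := Cy _ (nbhsx_ballx y e e0).
  by rewrite -ball_normE /= => yz; exists z.
exists (4 * n.+1%:R / r) => [|v eps eps0]; first by rewrite divr_gt0 ?mulr_gt0.
have [->|v0] := eqVneq v 0.
  by exists 0; rewrite ?(linear0 U) ?subrr !normr0 ?mulr0.
have nv0 : 0 < `|v| by rewrite normr_gt0.
(* [c *: v] has norm [r / 2], which keeps [x0 + c *: v] in the ball. *)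
pose c := r / 2 / `|v|.
have c0 : 0 < c by rewrite !divr_gt0.
have C1 : C n (x0 + c *: v).
  apply: ballC; rewrite -ball_normE /= opprD addNKr normrN normrZ gtr0_norm//.
  by rewrite /c divfK ?gt_eqF// ltr_pdivrMr// mulr_natr mulr2n ltrDl.
have C0 : C n x0 by apply: ballC; exact: ballxx.
have e0 : 0 < c * eps / 2 by rewrite !(divr_gt0, mulr_gt0).
have [z1 z1n z1c] := near_image _ _ C1 e0.
have [z0 z0n z0c] := near_image _ _ C0 e0.
exists (c^-1 *: (z1 - z0)).
  rewrite normrZ gtr0_norm ?invr_gt0// ler_pdivrMl//.
  have -> : c * (4 * n.+1%:R / r * `|v|) = n.+1%:R *+ 2.
    rewrite /c; set a := `|v| in nv0 *; have := gt_eqF r0; have := gt_eqF nv0.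
    by move=> /negbT ? /negbT ?; field; apply/andP.
  rewrite (le_trans (ler_normB _ _))// mulr2n.
  by apply: lerD; apply: (le_trans (y := n%:R)) => //; rewrite ler_nat.
have -> : v - U (c^-1 *: (z1 - z0)) = c^-1 *: ((x0 + c *: v - U z1) - (x0 - U z0)).
  have -> : x0 + c *: v - U z1 - (x0 - U z0) = c *: v - (U z1 - U z0).
    by rewrite !opprB [U z0 - x0]addrC addrACA [x0 + _]addrC addrK [- _ + _]addrC.
  by rewrite linearZ_LR linearB [RHS]scalerBr scalerA mulVf ?gt_eqF// scale1r.
rewrite normrZ gtr0_norm ?invr_gt0// ltr_pdivrMl//.
rewrite (le_lt_trans (ler_normB _ _))// [X in _ < X]splitr.
by rewrite ltrD.
Qed.

(** Correcting the error of an approximate preimage by halves writes [U z] as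
    the sum of a series [U (b k)] with [|b k|] below a geometric sequence.  As
    [U] is continuous and injective, the series [b] sums to [z], and its norm is
    bounded by the sum of the geometric series. *)
Lemma bounded_inverse : continuous U -> bijective U ->
  exists2 M : R, 0 < M & forall z, `|z| <= M * `|U z|.
Proof.
move=> U_cont U_bij; have [S US SU] := U_bij.
have [K K0 HK] := approximate_inverse_bound U_bij.
have /choice[a Ha] w : exists z, `|z| <= K * `|w| /\ `|w - U z| <= `|w| / 2.
  have [->|w0] := eqVneq w 0.
    by exists 0; rewrite (linear0 U) subrr !normr0 mulr0 mul0r.
  have [|z zK zw] := HK w (`|w| / 2); first by rewrite divr_gt0 ?normr_gt0.
  by exists z; split=> //; exact: ltW.
exists (2 * K) => [|z]; first by rewrite mulr_gt0.
(* [w k] is the error left after [k] corrections. *)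
pose w := fix w k := if k is k'.+1 then w k' - U (a (w k')) else U z.
have wS k : w k.+1 = w k - U (a (w k)) by [].
have w_le k : `|w k| <= `|U z| * 2^-1 ^+ k.
  elim: k => [|k IH]; first by rewrite expr0 mulr1.
  have [_ /le_trans->//] := Ha (w k).
  by rewrite exprSr mulrA ler_pM2r ?invr_gt0.
pose b : V^nat := a \o w.
have b_le k : `|b k| <= geometric (K * `|U z|) 2^-1 k.
  have [+ _] := Ha (w k); move/le_trans; apply.
  by rewrite /= -mulrA ler_pM2l.
have half1 : `|2^-1 : R| < 1 by rewrite ger0_norm ?invr_ge0// invf_lt1 ?ltr1n.
have cvg_norms : cvgn [normed series b].
  apply: (series_le_cvg _ _ b_le) => // [k|]; last exact: is_cvg_geometric_series.
  exact: le_trans (b_le k).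
have sum_b n : U (series b n) = U z - w n.
  elim: n => [|n IH]; first by rewrite /series /= big_geq// (linear0 U) subrr.
  by rewrite seriesSr (linearD U) IH wS opprB -addrA [- _ + _]addrC.
have wto0 : w @ \oo --> 0.
  apply/norm_cvg0P; apply: (@squeeze_cvgr _ _ _ _ (cst 0) (geometric `|U z| 2^-1)).
  - by near=> n; rewrite normr_ge0 /=.
  - exact: cvg_cst.
  - exact: cvg_geometric.
have lim_b : limn (series b) = z.
  apply: (can_inj US).
  apply: (@cvg_unique _ (@norm_hausdorff _ W) (U z - w n @[n --> \oo])).
    rewrite -(_ : U \o series b = fun n => U z - w n); last exact/funext.
    by apply: continuous_cvg; [exact: U_cont|exact: normed_cvg].
  have : (cst (U z) - w) @ \oo --> U z - 0 by apply: cvgB => //; exact: cvg_cst.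
  by rewrite subr0.
rewrite -[in X in X <= _]lim_b (le_trans (lim_series_norm cvg_norms))//.
have geo := @cvg_geometric_series R (K * `|U z|) _ half1.
have -> : 2 * K * `|U z| = limn (series (geometric (K * `|U z|) 2^-1)).
  by rewrite (cvg_lim _ geo)//; field.
by apply: lim_series_le => //; exact: cvgP geo.
Unshelve. all: by end_near. Qed.

End BoundedInverse.

(** * Right quaternionic inner products *)

Section Quaternions.
Variable R : realType.
Implicit Types (p q : quat R) (r : R).

Lemma quat_conjM p q : quat_conj (p * q) = quat_conj q * quat_conj p.
Proof. by congr Quat => /=; ring. Qed.

Lemma quat_conj0 : quat_conj 0 = 0 :> quat R.
Proof. by congr Quat; rewrite /= oppr0. Qed.

Lemma quat_norm_ge0 q : 0 <= quat_norm q.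
Proof. exact: sqrtr_ge0. Qed.

Lemma quat_norm_sqr q : quat_norm q ^+ 2 = qre (quat_conj q * q).
Proof. by rewrite sqr_sqrtr// qre_conj_mul !addr_ge0 ?sqr_ge0. Qed.

Lemma quat_norm_real r : 0 <= r -> quat_norm (quatR r) = r.
Proof.
move=> r0; rewrite /quat_norm qre_conj_mul /=.
by rewrite expr0n /= !addr0 sqrtr_sqr ger0_norm.
Qed.

Lemma quatRD r s : quatR (r + s) = quatR r + quatR s.
Proof. by congr Quat; rewrite /= addr0. Qed.

Lemma quat_norm_eq0 q : (quat_norm q == 0) = (q == 0).
Proof.
apply/idP/eqP => [/eqP q0|->]; last by rewrite quat_norm_real.
apply/eqP; apply: contraTT isT => /qre_conj_mul_neq0.
by rewrite -quat_norm_sqr q0 expr0n eqxx.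
Qed.

Lemma qre_sum (I : Type) (s : seq I) (F : I -> quat R) :
  qre (\sum_(i <- s) F i) = \sum_(i <- s) qre (F i).
Proof. exact: (big_morph (@qre R)). Qed.

End Quaternions.

Section RightScaling.
Variables (R : realType) (V : rightQuatHilbertType R).
Implicit Types (u v : V) (p q : quat R) (x : nat -> V) (c d : nat -> quat R).

Lemma rscale0l q : (0 : V) *r q = 0.
Proof. by apply: (addrI (0 *r q)); rewrite -rscaleDl !addr0. Qed.

Lemma rscale0r v : v *r 0 = 0.
Proof. by apply: (addrI (v *r 0)); rewrite -rscaleDr !addr0. Qed.

Lemma rscaleN1 v : v *r (- 1) = - v.
Proof.
by apply: (addrI v); rewrite -{1}[v]rscale1 -rscaleDr !subrr rscale0r.
Qed.

Lemma rscale_suml (I : Type) (s : seq I) (F : I -> V) q :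
  (\sum_(i <- s) F i) *r q = \sum_(i <- s) F i *r q.
Proof.
by apply: (big_morph (fun v => v *r q) (fun u v => rscaleDl u v q)); exact: rscale0l.
Qed.

Lemma qdot0r v : qdot v 0 = 0.
Proof. by rewrite -(rscale0r 0) qdotZr mulr0. Qed.

Lemma qdotZl u v q : qdot (u *r q) v = quat_conj q * qdot u v.
Proof. by rewrite -conj_qdot qdotZr quat_conjM conj_qdot. Qed.

Lemma qdotNr u v : qdot u (- v) = - qdot u v.
Proof. by rewrite -rscaleN1 qdotZr mulrN1. Qed.

Lemma qdot_sumr (I : Type) (s : seq I) (F : I -> V) v :
  qdot v (\sum_(i <- s) F i) = \sum_(i <- s) qdot v (F i).
Proof. exact: (big_morph (qdot v) (qdotDr v) (qdot0r v)). Qed.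

Lemma qdotDl u v w : qdot (u + v) w = qdot u w + qdot v w.
Proof.
by rewrite -conj_qdot qdotDr -(conj_qdot u) -(conj_qdot v); congr Quat => /=; ring.
Qed.

Lemma qdot_suml (I : Type) (s : seq I) (F : I -> V) v :
  qdot (\sum_(i <- s) F i) v = \sum_(i <- s) qdot (F i) v.
Proof.
apply: (big_morph (qdot^~ v) (fun u w => qdotDl u w v)).
by rewrite -conj_qdot qdot0r quat_conj0.
Qed.

Lemma qdot_self v : qdot v v = quatR (`|v| ^+ 2).
Proof.
rewrite normE; have [->|/qdot_gt0[r r0 ->]] := eqVneq v 0.
  by rewrite qdot0r /= sqrtr0 expr0n.
by rewrite /= sqr_sqrtr// ltW.
Qed.

Lemma norm_rscale v q : `|v *r q| = `|v| * quat_norm q.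
Proof.
rewrite normE qdotZl qdotZr qdot_self mulrA -quatRC -mulrA.
rewrite -[RHS]ger0_norm ?mulr_ge0 ?quat_norm_ge0// -sqrtr_sqr exprMn quat_norm_sqr.
by congr Num.sqrt; rewrite /=; ring.
Qed.

Definition rcomb x n c : V := \sum_(i < n) x i *r c i.

Lemma rcomb0 x c : rcomb x 0 c = 0.
Proof. exact: big_ord0. Qed.

Lemma rcombS x n c : rcomb x n.+1 c = rcomb x n c + x n *r c n.
Proof. exact: big_ord_recr. Qed.

Lemma rcomb_delta x n : rcomb x n.+1 (fun i => (i == n)%:R) = x n.
Proof.
rewrite rcombS eqxx rscale1 /rcomb big1 ?add0r// => i _.
by rewrite (ltn_eqF (ltn_ord i)) rscale0r.
Qed.

Lemma rcomb_widen x c n m : (n <= m)%N ->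
  rcomb x n c = rcomb x m (fun i => if (i < n)%N then c i else 0).
Proof.
move=> nm; rewrite /rcomb (big_ord_widen _ (fun i => x i *r c i) nm) big_mkcond.
by apply: eq_bigr => i _; case: ifP; rewrite // rscale0r.
Qed.

Lemma rcombD x n c d : rcomb x n c + rcomb x n d = rcomb x n (fun i => c i + d i).
Proof. by rewrite -big_split; apply: eq_bigr => i _; rewrite rscaleDr. Qed.

Lemma rcombZ x n c q : rcomb x n c *r q = rcomb x n (fun i => c i * q).
Proof. by rewrite rscale_suml; apply: eq_bigr => i _; rewrite rscaleA. Qed.

Lemma orthonormal_rcomb_norm x n c :
  (forall i j, qdot (x i) (x j) = (i == j)%:R) ->
  `|rcomb x n c| ^+ 2 = \sum_(i < n) quat_norm (c i) ^+ 2.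
Proof.
move=> xon; have := qdot_self (rcomb x n c); move/(congr1 (@qre R)) => /= <-.
rewrite qdot_suml qre_sum; apply: eq_bigr => i _.
rewrite qdot_sumr (bigD1 i)//= big1 ?addr0 => [|j ji].
  by rewrite qdotZl qdotZr xon eqxx mul1r quat_norm_sqr.
move: ji; rewrite -val_eqE eq_sym => /negbTE/= ij.
by rewrite qdotZl qdotZr xon ij mul0r mulr0.
Qed.

Lemma dense_normP (A : set V) :
  dense A <-> forall v (eps : R), 0 < eps -> exists2 a, A a & `|v - a| < eps.
Proof.
split=> [dA v eps eps0|HA D [v Dv] Dop].
  have [|a []] := dA _ _ (ball_open v eps); first by exists v; exact: ballxx.
  by rewrite -ball_normE /= => ? ?; exists a.
have /nbhs_ballP[e e0 eD] : nbhs v D by exact: open_nbhs_nbhs.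
by have [a Aa va] := HA v e e0; exists a; split=> //; apply: eD; rewrite -ball_normE.
Qed.

End RightScaling.

(** * The underlying real Banach space *)

(** A copy of [V], since [V] itself carries no real scaling. *)
Definition real_form (R : realType) (V : rightQuatHilbertType R) : Type := V.

Section RealForm.
Variables (R : realType) (V : rightQuatHilbertType R).

HB.instance Definition _ := PseudoMetricNormedZmod.copy (real_form V) V.

Let rscaler (r : R) (v : real_form V) : real_form V := (v : V) *r quatR r.

Let rscalerA a b v : rscaler a (rscaler b v) = rscaler (a * b) v.
Proof. by rewrite /rscaler rscaleA quatRM mulrC. Qed.

Let rscaler1 : left_id 1 rscaler.
Proof. by move=> v; rewrite /rscaler; exact: rscale1. Qed.

Let rscalerDr : right_distributive rscaler +%R.
Proof. by move=> a u v; rewrite /rscaler rscaleDl. Qed.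

Let rscalerDl v : {morph rscaler^~ v : a b / a + b}.
Proof. by move=> a b; rewrite /rscaler quatRD rscaleDr. Qed.

HB.instance Definition _ := GRing.Zmodule_isLmodule.Build R (real_form V)
  rscalerA rscaler1 rscalerDr rscalerDl.

Let norm_rscaler (r : R) (v : real_form V) : `|r *: v| = `|r| * `|v|.
Proof.
rewrite /GRing.scale/= norm_rscale mulrC; congr (_ * _).
by rewrite /quat_norm qre_conj_mul /= expr0n /= !addr0 sqrtr_sqr.
Qed.

HB.instance Definition _ :=
  PseudoMetricNormedZmod_Lmodule_isNormedModule.Build R (real_form V) norm_rscaler.

HB.instance Definition _ :=
  Uniform_isComplete.Build (real_form V) (@hilbert_complete R V).

End RealForm.

(** Multiplying by real quaternions turns right linearity into real linearity,
    so [T] is a bounded operator of the Banach space [real_form V]. *)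
Lemma right_linear_bounded_inverse (R : realType) (V : rightQuatHilbertType R)
    (T : V -> V) : bounded_op T -> right_linear T -> bijective T ->
  exists2 M : R, 0 < M & forall v, `|v| <= M * `|T v|.
Proof.
move=> [K K0 TK] Tlin Tbij.
have Tlin' : linear (T : real_form V -> real_form V).
  move=> a u v; have := Tlin u v (quatR a) 1.
  by rewrite !rscale1.
pose T' : {linear real_form V -> real_form V} :=
  HB.pack (T : real_form V -> real_form V) (GRing.isLinear.Build _ _ _ _ _ Tlin').
apply: (@bounded_inverse R (real_form V) (real_form V) T') => //.
apply/linear_bounded_continuous; apply/bounded_funP => r.
exists (K * r) => v vr.
exact: le_trans (TK v) (ler_wpM2l K0 vr).
Qed.

(** * Extending bounded linear relations *)

Section Extension.
Variables (R : realType) (V : rightQuatHilbertType R).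
Implicit Types (G : V -> V -> Prop) (u v w a b : V) (p q : quat R).

(** Relations rather than functions: the correspondence between combinations
    of two sequences is given by its graph, and its inverse by the converse
    relation. *)
Definition linear_rel G := forall a b a' b' p q, G a b -> G a' b' ->
  G (a *r p + a' *r q) (b *r p + b' *r q).

Definition bounded_rel G := exists2 C : R, 0 <= C &
  forall a b, G a b -> `|b| <= C * `|a|.

Definition rel_closure G v w := forall eps : R, 0 < eps ->
  exists a b, [/\ G a b, `|v - a| < eps & `|w - b| < eps].

Lemma sub_rel_closure G a b : G a b -> rel_closure G a b.
Proof. by move=> Gab e e0; exists a, b; rewrite !subrr !normr0. Qed.

Lemma rel_closure_norm G (C : R) : 0 <= C -> (forall a b, G a b -> `|b| <= C * `|a|) ->
  forall v w, rel_closure G v w -> `|w| <= C * `|v|.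
Proof.
move=> C0 GC v w Gvw; apply/ler_addgt0Pr => e e0.
have C1 : 0 < C + 1 by rewrite ltr_wpDl.
have [|a [b [Gab va wb]]] := Gvw (e / (C + 1)); first exact: divr_gt0.
have wE : `|w| <= `|w - b| + `|b| by rewrite -{1}(subrK b w) ler_normD.
have aE : `|a| <= `|v - a| + `|v| by rewrite distrC -{1}(subrK v a) ler_normD.
have := ler_wpM2l C0 aE; have := GC _ _ Gab.
have : C * `|v - a| <= C * (e / (C + 1)) by rewrite ler_wpM2l// ltW.
have : e / (C + 1) + C * (e / (C + 1)) = e by field; rewrite gt_eqF.
by lra.
Qed.

Lemma linear_rel_closure G : linear_rel G -> linear_rel (rel_closure G).
Proof.
move=> Glin v w v' w' p q Gvw Gvw' e e0.
pose N := quat_norm p + quat_norm q + 1.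
have [p0 q0] := (quat_norm_ge0 p, quat_norm_ge0 q).
have N0 : 0 < N by rewrite ltr_wpDl// addr_ge0.
have dist a a' u u' : `|u - a| < e / N -> `|u' - a'| < e / N ->
    `|u *r p + u' *r q - (a *r p + a' *r q)| < e.
  move=> ua ua'.
  have -> : u *r p + u' *r q - (a *r p + a' *r q) = (u - a) *r p + (u' - a') *r q.
    by rewrite opprD addrACA !rscaleDl -!rscaleN1 !rscaleA !mulN1r !mulrN1.
  rewrite (le_lt_trans (ler_normD _ _))// !norm_rscale.
  have := ler_wpM2r p0 (ltW ua); have := ler_wpM2r q0 (ltW ua').
  have : e / N * quat_norm p + e / N * quat_norm q + e / N = e.
    by rewrite /N; field; rewrite gt_eqF.
  have : 0 < e / N by rewrite divr_gt0.
  by lra.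
have [|a [b [Gab va wb]]] := Gvw (e / N); first exact: divr_gt0.
have [|a' [b' [Gab' va' wb']]] := Gvw' (e / N); first exact: divr_gt0.
by exists (a *r p + a' *r q), (b *r p + b' *r q); split;
  [exact: Glin|exact: dist|exact: dist].
Qed.

(** The images [b] of approximants [a] of [v] form a Cauchy sequence, because
    the bound on [G] applies to their differences. *)
Lemma rel_closure_total G : linear_rel G -> bounded_rel G ->
  dense [set a | exists b, G a b] -> forall v, exists w, rel_closure G v w.
Proof.
move=> Glin [C C0 GC] /dense_normP Gdense v.
have Gsub a b a' b' : G a b -> G a' b' -> G (a - a') (b - b').
  by move=> Gab /(Glin _ _ _ _ 1 (- 1) Gab); rewrite !rscale1 !rscaleN1.
have /choice[ab Hab] k : exists ab : V * V, G ab.1 ab.2 /\ `|v - ab.1| < k.+1%:R^-1.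
  have [|a [b Gab] va] := Gdense v k.+1%:R^-1; first by rewrite invr_gt0.
  by exists (a, b).
have C1 : 0 < C + 1 by rewrite ltr_wpDl.
have small (e : R) : 0 < e -> exists k, forall m, (k <= m)%N -> m.+1%:R^-1 < e.
  move=> e0; exists (truncn e^-1) => m km.
  rewrite -ltf_pV2 ?posrE ?invr_gt0// invrK.
  by rewrite (lt_le_trans (truncnS_gt _))// ler_nat.
have near_v (e : R) : 0 < e -> exists k, forall m, (k <= m)%N -> `|v - (ab m).1| < e.
  by move=> /small[k Hk]; exists k => m /Hk; apply: lt_trans; have [] := Hab m.
have : cvg ((snd \o ab) @ \oo).
  apply: hilbert_complete; apply: cauchy_exP => e e0.
  have [|k Hk] := near_v (e / 2 / (C + 1)); first by rewrite !divr_gt0.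
  exists (ab k).2; exists k => // m /= km; rewrite -ball_normE /=.
  have /GC/le_lt_trans-> // := Gsub _ _ _ _ (proj1 (Hab k)) (proj1 (Hab m)).
  have kmE : `|(ab k).1 - (ab m).1| < e / (C + 1).
    rewrite (_ : _ - _ = (v - (ab m).1) - (v - (ab k).1)); last first.
      by rewrite opprB [RHS]addrC addrA subrK.
    rewrite (le_lt_trans (ler_normB _ _))//.
    have := Hk _ km; have := Hk _ (leqnn k).
    have -> : e / (C + 1) = e / 2 / (C + 1) + e / 2 / (C + 1) by field; rewrite gt_eqF.
    by move=> *; rewrite ltrD.
  rewrite (le_lt_trans (ler_wpM2l C0 (ltW kmE)))// mulrCA gtr_pMr//.
  by rewrite ltr_pdivrMr// mul1r ltrDl.
move=> /cvg_ex[w wlim]; exists w => e e0.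
have [k Hk] := near_v e e0.
have [k' _ Hk'] := (cvgrPdist_lt _ _).1 wlim e e0.
exists (ab (maxn k k')).1, (ab (maxn k k')).2; split.
- by have [] := Hab (maxn k k').
- by apply: Hk; rewrite leq_maxl.
- by apply: Hk'; rewrite /= leq_maxr.
Qed.

(** The closure of [G] is the graph of the extension.  It is single-valued
    because it is linear and relates [0] only to [0]. *)
Lemma extend_linear_rel G : linear_rel G -> bounded_rel G ->
    dense [set a | exists b, G a b] ->
  exists T : V -> V, [/\ bounded_op T, right_linear T &
    forall v w, rel_closure G v w <-> T v = w].
Proof.
move=> Glin Gbnd Gdense; have [C C0 GC] := Gbnd.
have Clin := linear_rel_closure Glin; have Cnorm := rel_closure_norm C0 GC.
have /choice[T HT] := rel_closure_total Glin Gbnd Gdense.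
have Cfun v w : rel_closure G v w <-> T v = w.
  split=> [vw|<-//].
  have := Clin _ _ _ _ 1 (- 1) (HT v) vw.
  rewrite !rscale1 !rscaleN1 subrr => /Cnorm.
  by rewrite normr0 mulr0 normr_le0 subr_eq0 => /eqP.
exists T; split=> //; first by exists C => // v; apply: Cnorm.
by move=> u v p q; apply/Cfun/Clin.
Qed.

(** The hypotheses are symmetric in the two sides and the closure of the
    converse relation is the converse of the closure, so the extensions of [G]
    and of its converse are inverse to each other. *)
Lemma extend_linear_iso G : linear_rel G ->
    bounded_rel G -> dense [set a | exists b, G a b] ->
    bounded_rel (fun b a => G a b) -> dense [set b | exists a, G a b] ->
  exists T : V -> V, [/\ bounded_op T, right_linear T, bijective T &
    forall a b, G a b -> T a = b].
Proof.
move=> Glin Gbnd Gdom Gbnd' Gran.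
have [T [Tbnd Tlin TG]] := extend_linear_rel Glin Gbnd Gdom.
have Glin' : linear_rel (fun b a => G a b) by move=> b a b' a' p q; exact: Glin.
have [S [_ _ SG]] := extend_linear_rel Glin' Gbnd' Gran.
have symm v w : rel_closure G v w <-> rel_closure (fun b a => G a b) w v.
  by split=> H e /H [a [b [? ? ?]]]; exists b, a.
exists T; split=> //; last by move=> a b /sub_rel_closure/TG.
by exists S => v; [apply/SG/symm/TG | apply/TG/symm/SG].
Qed.

End Extension.

(** * The Gram-Schmidt process *)

Section GramSchmidt.
Variables (R : realType) (V : rightQuatHilbertType R).
Implicit Types (x e : nat -> V) (u v : V) (c : nat -> quat R).

Definition right_free x := forall n c, rcomb x n c = 0 ->
  forall i, (i < n)%N -> c i = 0.

Definition spans_upto x n v := exists c, v = rcomb x n c.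

Lemma spans_uptoW x n m v : (n <= m)%N -> spans_upto x n v -> spans_upto x m v.
Proof. by move=> nm [c ->]; rewrite (rcomb_widen _ _ nm); eexists. Qed.

Lemma spans_uptoD x n u v : spans_upto x n u -> spans_upto x n v ->
  spans_upto x n (u + v).
Proof. by move=> [c ->] [d ->]; rewrite rcombD; eexists. Qed.

Lemma spans_uptoZ x n u q : spans_upto x n u -> spans_upto x n (u *r q).
Proof. by move=> [c ->]; rewrite rcombZ; eexists. Qed.

Lemma spans_uptoN x n u : spans_upto x n u -> spans_upto x n (- u).
Proof. by rewrite -rscaleN1; exact: spans_uptoZ. Qed.

Lemma spans_upto_rcomb x e n m c :
  (forall i, (i < n)%N -> spans_upto x m (e i)) -> spans_upto x m (rcomb e n c).
Proof.
elim: n => [|n IH] xe.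
  rewrite rcomb0; exists (fun=> 0).
  by rewrite /rcomb big1// => i _; rewrite rscale0r.
rewrite rcombS; apply: spans_uptoD.
  by apply: IH => i /ltnW; exact: xe.
by apply: spans_uptoZ; exact: xe.
Qed.

Lemma spans_upto_self x n : spans_upto x n.+1 (x n).
Proof. by exists (fun i => (i == n)%:R); rewrite rcomb_delta. Qed.

Lemma right_free_notin x n : right_free x -> ~ spans_upto x n (x n).
Proof.
move=> xfree [c xn].
pose d i := if (i < n)%N then c i else - 1.
have d0 : rcomb x n.+1 d = 0.
  rewrite rcombS {2}/d ltnn rscaleN1; apply/eqP; rewrite subr_eq0 xn.
  by apply/eqP; apply: eq_bigr => i _; rewrite /d ltn_ord.
have /eqP := xfree _ _ d0 n (ltnSn n).
by rewrite /d ltnn oppr_eq0 oner_eq0.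
Qed.

Definition normalize v := v *r quatR `|v|^-1.
Definition residual x n e := x n - rcomb e n (fun i => qdot (e i) (x n)).

(** The term of index [n] depends on all earlier terms, so the recursion builds
    the whole function one more correct value at a time; from [n] on the
    values are [0]. *)
Fixpoint gram_schmidt_prefix x n : nat -> V :=
  if n is m.+1 then
    fun i => if i == m then normalize (residual x m (gram_schmidt_prefix x m))
             else gram_schmidt_prefix x m i
  else fun=> 0.

Definition gram_schmidt x n := gram_schmidt_prefix x n.+1 n.

Lemma gram_schmidt_prefixE x n i : (i < n)%N ->
  gram_schmidt_prefix x n i = gram_schmidt x i.
Proof.
elim: n => // n IH; rewrite ltnS leq_eqVlt => /orP[/eqP->|lt_in] //=.
by rewrite (ltn_eqF lt_in) IH.
Qed.

Lemma gram_schmidtE x n : gram_schmidt x n = normalize (residual x n (gram_schmidt x)).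
Proof.
rewrite /gram_schmidt /= eqxx; congr (normalize (_ - _)).
by apply: eq_bigr => i _; rewrite gram_schmidt_prefixE.
Qed.

Lemma gram_schmidt_in_span x n : spans_upto x n.+1 (gram_schmidt x n).
Proof.
elim/ltn_ind: n => n IH; rewrite gram_schmidtE; apply: spans_uptoZ; apply: spans_uptoD.
  exact: spans_upto_self.
apply/spans_uptoN/spans_upto_rcomb => i lt_in.
exact: spans_uptoW (leqW lt_in) (IH _ lt_in).
Qed.

(** Otherwise [x n] would be a combination of the earlier terms of the
    orthonormalized sequence, hence of the earlier terms of [x]. *)
Lemma residual_neq0 x n : right_free x -> residual x n (gram_schmidt x) != 0.
Proof.
move=> xfree; apply/eqP => /eqP; rewrite subr_eq0 => /eqP xn.
apply: (@right_free_notin x n xfree); rewrite xn; apply: spans_upto_rcomb => i lt_in.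
exact: spans_uptoW lt_in (gram_schmidt_in_span x i).
Qed.

(** Projections onto the earlier terms are subtracted, so each term is
    orthogonal to those before it; the conjugate symmetry of the inner product
    covers the other order. *)
Lemma gram_schmidt_orthonormal x : right_free x ->
  forall i j, qdot (gram_schmidt x i) (gram_schmidt x j) = (i == j)%:R.
Proof.
move=> xfree; set e := gram_schmidt x.
have normal n : qdot (e n) (e n) = 1.
  have := residual_neq0 n xfree; rewrite -normr_gt0 /e gram_schmidtE => r0.
  rewrite qdot_self norm_rscale quat_norm_real ?invr_ge0// mulfV ?gt_eqF//.
  by rewrite expr1n.
suff lt_orth n : forall i, (i < n)%N -> qdot (e i) (e n) = 0.
  move=> i j; have [ij|ij|->] := ltngtP i j; last exact: normal.
  - exact: lt_orth.
  - by rewrite -conj_qdot lt_orth// quat_conj0.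
elim/ltn_ind: n => n IH i lt_in.
rewrite {2}/e gram_schmidtE qdotZr qdotDr qdotNr -/e qdot_sumr.
rewrite (bigD1 (Ordinal lt_in))//= qdotZr normal mul1r.
rewrite big1 ?addr0 ?subrr ?mul0r// => j ji.
rewrite qdotZr; have [ij|ij|/eqP ij] := ltngtP i j.
- by rewrite IH// mul0r.
- by rewrite -conj_qdot IH// quat_conj0 mul0r.
- by move: ji; rewrite -val_eqE/= eq_sym ij.
Qed.

Lemma in_span_gram_schmidt x n : right_free x ->
  spans_upto (gram_schmidt x) n.+1 (x n).
Proof.
move=> xfree; set e := gram_schmidt x; set r := residual x n e.
have r0 : 0 < `|r| by rewrite normr_gt0 residual_neq0.
have -> : x n = e n *r quatR `|r| + rcomb e n (fun i => qdot (e i) (x n)).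
  rewrite {1}/e gram_schmidtE rscaleA quatRM mulVf ?gt_eqF// rscale1.
  by rewrite subrK.
apply: spans_uptoD; first by apply: spans_uptoZ; exact: spans_upto_self.
by apply: (@spans_uptoW e n) => //; eexists.
Qed.

End GramSchmidt.

(** * Riesz sequences and Riesz bases *)

Section Riesz.
Variables (R : realType) (V : rightQuatHilbertType R).
Implicit Types (x e : nat -> V) (c : nat -> quat R).

Lemma right_linear_rcomb (T : V -> V) e n c : right_linear T ->
  T (rcomb e n c) = rcomb (T \o e) n c.
Proof.
move=> Tlin; have T0 : T 0 = 0.
  by have := Tlin 0 0 0 0; rewrite !rscale0r addr0.
elim: n => [|n IH]; first by rewrite !rcomb0.
by rewrite !rcombS -IH -[rcomb e n c in LHS]rscale1 Tlin rscale1.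
Qed.

(** Vanishing from rank [n] on does not constrain the first [n] coefficients. *)
Lemma riesz_seqP x : riesz_seq x <-> exists A B : R, [/\ 0 < A, 0 < B &
  forall n c, A * (\sum_(i < n) quat_norm (c i) ^+ 2) <= `|rcomb x n c| ^+ 2
                <= B * (\sum_(i < n) quat_norm (c i) ^+ 2)].
Proof.
split=> -[A [B [A0 B0 H]]]; exists A, B; split=> //.
  move=> n c; pose d i := if (i < n)%N then c i else 0.
  have -> : rcomb x n c = rcomb x n d by rewrite (rcomb_widen x c (leqnn n)).
  have -> : \sum_(i < n) quat_norm (c i) ^+ 2 = \sum_(i < n) quat_norm (d i) ^+ 2.
    by apply: eq_bigr => i _; rewrite /d ltn_ord.
  by apply: H => i; rewrite /d ltnNge => ->.
Qed.

(** The lower Riesz bound forces the coefficients of a null combination to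
    vanish. *)
Lemma riesz_seq_right_free x : riesz_seq x -> right_free x.
Proof.
move=> /riesz_seqP[A [B [A0 _ xAB]]] n c c0 i lt_in.
have := xAB n c; rewrite c0 normr0 expr0n /= => /andP[+ _].
rewrite pmulr_rle0// (bigD1 (Ordinal lt_in))//= => H.
apply/eqP; rewrite -quat_norm_eq0 -sqrf_eq0 eq_le sqr_ge0 andbT.
by apply: le_trans H; rewrite lerDl sumr_ge0// => *; exact: sqr_ge0.
Qed.

Lemma riesz_basis_complete_seq x : riesz_basis x -> complete_seq x.
Proof.
move=> [e [U [[_ edense] [[K K0 UK] Ulin [S SU US] xE]]]].
apply/dense_normP => v eps eps0.
have K1 : 0 < K + 1 by rewrite ltr_wpDl.
have [|_ [n [c ->]] Hc] := (dense_normP _).1 edense (S v) (eps / (K + 1)).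
  exact: divr_gt0.
exists (U (rcomb e n c)).
  by exists n, c; rewrite right_linear_rcomb//; apply: eq_bigr => i _; rewrite xE.
have -> : v - U (rcomb e n c) = U (S v - rcomb e n c).
  by have := Ulin (S v) (rcomb e n c) 1 (- 1); rewrite !rscale1 !rscaleN1 US.
rewrite (le_lt_trans (UK _))// (le_lt_trans (ler_wpM2l K0 (ltW Hc)))//.
by rewrite mulrCA gtr_pMr// ltr_pdivrMr// mul1r ltrDl.
Qed.

(** The lower bound is the bounded inverse theorem applied to the operator
    carrying the orthonormal basis to [x]. *)
Lemma riesz_basis_riesz_seq x : riesz_basis x -> riesz_seq x.
Proof.
move=> [e [U [[eon _] [Ubnd Ulin Ubij xE]]]].
have [M M0 UM] := right_linear_bounded_inverse Ubnd Ulin Ubij.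
have [K K0 UK] := Ubnd.
apply/riesz_seqP; exists (M ^- 2), (K ^+ 2 + 1); split.
- by rewrite invr_gt0 exprn_gt0.
- by rewrite ltr_wpDl ?sqr_ge0.
move=> n c; rewrite -(orthonormal_rcomb_norm n c eon).
have -> : rcomb x n c = U (rcomb e n c).
  by rewrite right_linear_rcomb//; apply: eq_bigr => i _; rewrite xE.
set v := rcomb e n c; apply/andP; split.
  rewrite ler_pdivrMl ?exprn_gt0// -exprMn.
  by rewrite lerXn2r ?nnegrE ?mulr_ge0// ltW.
apply: (@le_trans _ _ (K ^+ 2 * `|v| ^+ 2)); last by rewrite ler_wpM2r ?sqr_ge0// lerDl.
by rewrite -exprMn lerXn2r ?nnegrE ?mulr_ge0.
Qed.

(** The operator is the extension of the correspondence between combinations of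
    the orthonormalized sequence and combinations of [x] with the same
    coefficients. *)
Lemma complete_riesz_seq_basis x : complete_seq x -> riesz_seq x -> riesz_basis x.
Proof.
move=> xdense xriesz; have xfree := riesz_seq_right_free xriesz.
have [A [B [A0 B0 xAB]]] := (riesz_seqP x).1 xriesz.
pose e := gram_schmidt x.
have eon : forall i j, qdot (e i) (e j) = (i == j)%:R := gram_schmidt_orthonormal xfree.
have edense : dense (right_span e).
  move=> D D0 Dop; have [v [Dv [n [c vE]]]] := xdense D D0 Dop.
  exists (rcomb x n c); split; first by rewrite /rcomb -vE.
  have [|d ->] := @spans_upto_rcomb _ _ e x n n c; last by exists n, d.
  by move=> i lt_in; exact: spans_uptoW lt_in (in_span_gram_schmidt i xfree).
pose G u w := exists n c, u = rcomb e n c /\ w = rcomb x n c.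
have Glin : linear_rel G.
  move=> _ _ _ _ p q [n [c [-> ->]]] [m [d [-> ->]]].
  exists (maxn n m); eexists.
  rewrite !(rcomb_widen _ c (leq_maxl n m)) !(rcomb_widen _ d (leq_maxr n m)).
  by rewrite !rcombZ !rcombD.
have [||||U [Ubnd Ulin Ubij UG]] := @extend_linear_iso _ _ G Glin.
- exists (Num.sqrt B) => [|_ _ [n [c [-> ->]]]]; first exact: sqrtr_ge0.
  have /andP[_ ] := xAB n c; rewrite -(orthonormal_rcomb_norm n c eon) => H.
  rewrite -[X in X <= _]ger0_norm// -[X in _ <= _ * X]ger0_norm// -!sqrtr_sqr.
  by rewrite -sqrtrM ?ler_wsqrtr// ltW.
- move=> D D0 Dop; have [v [Dv [n [c vE]]]] := edense D D0 Dop.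
  by exists v; split=> //; exists (rcomb x n c), n, c.
- exists (Num.sqrt A^-1) => [|_ _ [n [c [-> ->]]]]; first exact: sqrtr_ge0.
  have /andP[+ _] := xAB n c; rewrite -(orthonormal_rcomb_norm n c eon) => H.
  rewrite -[X in X <= _]ger0_norm// -[X in _ <= _ * X]ger0_norm// -!sqrtr_sqr.
  rewrite -sqrtrM; last by rewrite invr_ge0 ltW.
  by rewrite ler_wsqrtr// ler_pdivlMl.
- move=> D D0 Dop; have [v [Dv [n [c vE]]]] := xdense D D0 Dop.
  by exists v; split=> //; exists (rcomb e n c), n, c.
exists e, U; split=> //; split=> // n; apply/esym/UG.
by exists n.+1, (fun i => (i == n)%:R); rewrite !rcomb_delta.
Qed.

End Riesz.

Theorem theorem3p7 (R : realType) (V : rightQuatHilbertType R)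
    (sepV : separable V) (X : nat -> V) :
  riesz_basis X <-> complete_seq X /\ riesz_seq X.
Proof.
split=> [Xbasis|[Xcomplete Xriesz]]; last exact: complete_riesz_seq_basis.
by split; [exact: riesz_basis_complete_seq|exact: riesz_basis_riesz_seq].
Qed.
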